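(* Let $0<\ell\le n$ be integers. Then the $R$-module $$\mathcal G_{\ell,\sigma}=\left\{\sum_{i=0}^{\ell-1}f_i\sigma^i : f_i\in S\right\}\subseteq S[G]$$ is an MRD code.
   Context: Setting: $G=\langle\sigma\rangle$ is a cyclic group of order $n$. A $G$-Galois extension is an extension $S/R$ of commutative rings such that $G$ is a subgroup of $\mathrm{Aut}(S/R)$ (automorphisms of $S$ as $R$-algebra), $S^G=R$, and the map $S\otimes_R S\to\bigoplus_{g\in G}S$, $x\otimes y\mapsto (xg(y))_{g\in G}$, is bijective. $S/R$ is an unramified $G$-Galois extension of local principal ideal rings, meaning: there is a $G$-Galois extension $\tilde S/\tilde R$ of discrete valuation rings and $\omega\in\tilde R$ such that $\tilde R\omega$ and $\tilde S\omega$ are the maximal ideals of $\tilde R$ and $\tilde S$, and either $R=\tilde R$, $S=\tilde S$, or $R=\tilde R/\tilde R\omega^k$, $S=\tilde S/\tilde S\omega^k$ for some $k\geq 1$, with $G$ acting on $S$ by the induced automorphisms; then $S/R$ is $G$-Galois and $S$ is a free $R$-module of rank $n$. $S[G]$ is the skew group algebra: the free $S$-module with basis $G$ and multiplication $(ag)(bh)=a\,g(b)\,gh$. It is identified with $\mathrm{End}_R(S)$ via $\sum_g a_g g\mapsto (x\mapsto\sum_g a_g g(x))$. For a finitely generated $R$-module $M$, $\mathrm{rk}_{\mathrm{inn}}(M,R)$ is the minimal number of generators of $M$; for $f\in S[G]$ viewed in $\mathrm{End}_R(S)$, $\mathrm{rk}_{\mathrm{inn}}(f,R)=\mathrm{rk}_{\mathrm{inn}}(f(S),R)$.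 The minimum rank distance of an $R$-linear code (a nonzero $R$-submodule) $\mathcal C\subseteq S[G]$ is $d(\mathcal C)=\min\{\mathrm{rk}_{\mathrm{inn}}(f,R): f\in\mathcal C\setminus\{0\}\}$. The code $\mathcal C$ is called MRD (maximum rank distance) if it is a free $R$-submodule of $S[G]$ with $\mathrm{rk}_{\mathrm{inn}}(\mathcal C,R)=n(n-d(\mathcal C)+1)$. *)

(* Defs.v *)
From HB Require Import structures.
From mathcomp Require Import all_boot all_order all_algebra all_fingroup.
From mathcomp Require Import generic_quotient ring_quotient boolp classical_sets.
From mathcomp Require Import freeg.

Set Implicit Arguments.
Unset Strict Implicit.
Unset Printing Implicit Defensive.

Import GRing.Theory.

Local Open Scope classical_set_scope.
Local Open Scope ring_scope.
Local Open Scope quotient_scope.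

Section Ideals.
Variable A : comNzRingType.
Implicit Types (I J : set A) (a x y : A).

Definition is_ideal I : Prop :=
  I 0 /\ forall a x y, I x -> I y -> I (a * x + y).

Definition principal a : set A := [set x | exists b, x = b * a].

Definition maximal_ideal I : Prop :=
  [/\ is_ideal I, I <> setT &
      forall J, is_ideal J -> I `<=` J -> J = I \/ J = setT].

(* Discrete valuation ring: a local principal ideal domain, not a field. *)
Definition is_dvr : Prop :=
  [/\ forall x y, x * y = 0 -> x = 0 \/ y = 0,
      forall I, is_ideal I -> exists a, I = principal a,
      exists! I, maximal_ideal I &
      exists2 x, x <> 0 & forall y, x * y <> 1].

End Ideals.

(* The tensor product M (x)_R N, as the free R-module on M * N modulo the
   submodule generated by the bilinearity relations (the coefficient c makes
   the generated subgroup a submodule). *)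
Section Tensor.
Variables (R : comNzRingType) (M N : lmodType R).

Local Notation F := {freeg (M * N)%type / R}.

Inductive tensor_relator : F -> Prop :=
| TensorAddl c m m' n : tensor_relator
    (<< c *g (m + m', n) >> - << c *g (m, n) >> - << c *g (m', n) >>)
| TensorAddr c m n n' : tensor_relator
    (<< c *g (m, n + n') >> - << c *g (m, n) >> - << c *g (m, n') >>)
| TensorScalel c a m n : tensor_relator
    (<< c *g (a *: m, n) >> - << c * a *g (m, n) >>)
| TensorScaler c a m n : tensor_relator
    (<< c *g (m, a *: n) >> - << c * a *g (m, n) >>).

Inductive tensor_null : F -> Prop :=
| TensorNull0 : tensor_null 0
| TensorNullRel z : tensor_relator z -> tensor_null z
| TensorNullB z w : tensor_null z -> tensor_null w -> tensor_null (z - w).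

Definition tensor_ker : pred F := fun z => `[< tensor_null z >].

Lemma tensor_ker_zmod_closed : zmod_closed tensor_ker.
Proof.
split=> [|z w]; first exact/asboolP/TensorNull0.
by move=> /asboolP hz /asboolP hw; apply/asboolP/TensorNullB.
Qed.

HB.instance Definition _ :=
  GRing.isZmodClosed.Build F tensor_ker tensor_ker_zmod_closed.

Definition tensor := {ideal_quot (GRing.ZmodClosed.clone F tensor_ker _)}.

Definition pure_tensor (m : M) (n : N) : tensor := \pi_tensor (<< (m, n) >>).

(* The map M (x) N -> P induced by a bilinear f. *)
Definition tensor_lift (P : lmodType R) (f : M -> N -> P) (t : tensor) : P :=
  fglift (fun p => f p.1 p.2) (repr t).

Section LiftTheory.
Variables (P : lmodType R) (f : M -> N -> P).
Hypothesis fl : forall n, linear (f^~ n).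
Hypothesis fr : forall m, linear (f m).

Let lf := fglift (fun p : M * N => f p.1 p.2).

Let lfB : {morph lf : z w / z - w}.
Proof. exact: lift_is_additive. Qed.

Lemma tensor_lift_pi (z : F) : tensor_lift f (\pi_tensor z) = lf z.
Proof.
have fDl m m' n : f (m + m') n = f m n + f m' n.
  by have := fl n 1 m m'; rewrite !scale1r.
have fDr m n n' : f m (n + n') = f m n + f m n'.
  by have := fr m 1 n n'; rewrite !scale1r.
have f0l n : f 0 n = 0 by apply: (addrI (f 0 n)); rewrite -fDl !addr0.
have f0r m : f m 0 = 0 by apply: (addrI (f m 0)); rewrite -fDr !addr0.
have fZl a m n : f (a *: m) n = a *: f m n.
  by have := fl n a m 0; rewrite addr0 f0l addr0.
have fZr a m n : f m (a *: n) = a *: f m n.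
  by have := fr m a n 0; rewrite addr0 f0r addr0.
have null w : tensor_null w -> lf w = 0.
  elim=> [|_ [c m m' n|c m n n'|c a m n|c a m n]|w1 w2 _ h1 _ h2].
  - by have := lfB 0 0; rewrite !subr0 subrr.
  - by rewrite !lfB /lf !liftU /= fDl scalerDr addrAC addrK subrr.
  - by rewrite !lfB /lf !liftU /= fDr scalerDr addrAC addrK subrr.
  - by rewrite !lfB /lf !liftU /= fZl scalerA subrr.
  - by rewrite !lfB /lf !liftU /= fZr scalerA subrr.
  - by rewrite lfB h1 h2 subrr.
apply/eqP; rewrite -subr_eq0 /tensor_lift -/lf -lfB; apply/eqP/null/asboolP.
have -> : forall x : F, `[< tensor_null x >] = (x \in tensor_ker) by [].
by rewrite Quotient.idealrBE reprK.
Qed.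

Lemma tensor_lift_pure m n : tensor_lift f (pure_tensor m n) = f m n.
Proof. by rewrite tensor_lift_pi /lf liftU scale1r. Qed.

Lemma tensor_liftB : {morph tensor_lift f : s t / s - t}.
Proof.
move=> s t; rewrite -[s]reprK -[t]reprK -raddfB !tensor_lift_pi; exact: lfB.
Qed.

End LiftTheory.

End Tensor.

(* Each act_fun g is bijective, with inverse act_fun g^-1: an automorphism. *)
Record alg_action (gT : finGroupType) (R : comNzRingType) (S : comAlgType R) :=
  AlgAction {
    act_fun :> gT -> {lrmorphism S -> S};
    act1 : forall x, act_fun 1%g x = x;
    actM : forall g h x, act_fun (g * h)%g x = act_fun g (act_fun h x)
  }.

Section Galois.
Variables (gT : finGroupType) (R : comNzRingType) (S : comAlgType R).
Variable act : alg_action gT S.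

Definition galois_tensor_map : tensor S S -> {ffun gT -> S} :=
  tensor_lift (fun x y => [ffun g => x * act g y]).

(* The four conditions: G embeds in Aut(S/R), R embeds in S, S^G = R, and the
   Galois map is bijective. *)
Definition is_galois : Prop :=
  [/\ forall g, (forall x, act g x = x) -> g = 1%g,
      injective (fun r : R => r%:A : S),
      forall x : S, (forall g, act g x = x) <-> exists r : R, x = r%:A &
      bijective galois_tensor_map].

End Galois.

(* R and S are the discrete valuation rings Rt and St, or their quotients by
   w^k: since quotients matter only up to isomorphism, they are given by
   surjective morphisms pR and pS with the prescribed kernels, compatible with
   the algebra structures and the actions. *)
Definition is_unramified_galois (gT : finGroupType) (R : comNzRingType)
    (S : comAlgType R) (act : alg_action gT S) : Prop :=
  exists (Rt : comNzRingType) (St : comAlgType Rt) (actt : alg_action gT St)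
    (w : Rt) (pR : {rmorphism Rt -> R}) (pS : {rmorphism St -> S}),
    [/\ [/\ is_dvr Rt, is_dvr St & is_galois actt],
        maximal_ideal (principal w) /\ maximal_ideal (principal (w%:A : St)),
        (forall r, exists rt, pR rt = r) /\ (forall s, exists st, pS st = s),
        (forall rt, pS (rt%:A) = (pR rt)%:A) /\
        (forall g st, pS (actt g st) = act g (pS st)) &
        (injective pR /\ injective pS) \/
        exists2 k, (0 < k)%N &
          (forall rt, pR rt = 0 <-> principal (w ^+ k) rt) /\
          (forall st, pS st = 0 <-> principal ((w ^+ k)%:A : St) st)].

Section SkewGroupAlgebra.
Variables (gT : finGroupType) (R : comNzRingType) (S : comAlgType R).
Variable act : alg_action gT S.

(* f : skew_group_algebra act stands for \sum_g f(g) g in S[G]. *)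
Definition skew_group_algebra of alg_action gT S : Type := {ffun gT -> S}.

HB.instance Definition _ (a : alg_action gT S) :=
  GRing.Lmodule.copy (skew_group_algebra a) {ffun gT -> S}.

Local Notation SG := (skew_group_algebra act).

Implicit Types f g h : SG.

(* The element a g of S[G]. *)
Definition skew_mono (a : S) (u : gT) : SG :=
  [ffun v => if v == u then a else 0].

Definition skew_mul f g : SG :=
  \sum_u \sum_v skew_mono (f u * act u (g v)) (u * v)%g.

Lemma skew_mulE f g w :
  skew_mul f g w = \sum_u f u * act u (g (u^-1 * w)%g).
Proof.
rewrite /skew_mul sum_ffunE; apply: eq_bigr => u _; rewrite sum_ffunE.
rewrite (bigD1 (u^-1 * w)%g) //= ffunE mulKVg eqxx big1 ?addr0 // => v hv.
by rewrite ffunE -(inj_eq (mulgI u^-1%g)) mulKg eq_sym (negPf hv).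
Qed.

Lemma skew_mulA : associative skew_mul.
Proof.
move=> f g h; apply/ffunP => w; rewrite !skew_mulE.
under [RHS]eq_bigr do rewrite skew_mulE mulr_suml.
rewrite exchange_big /=; apply: eq_bigr => u _.
rewrite skew_mulE raddf_sum mulr_sumr (reindex_inj (mulgI u^-1%g)) /=.
apply: eq_bigr => v _.
by rewrite rmorphM /= mulrA -actM mulKVg invMg invgK -mulgA mulKVg.
Qed.

Lemma skew_mul1l : left_id (skew_mono 1 1%g) skew_mul.
Proof.
move=> f; apply/ffunP => w; rewrite skew_mulE (bigD1 1%g) //= ffunE eqxx.
rewrite mul1r act1 invg1 mul1g big1 ?addr0 // => u hu.
by rewrite ffunE (negPf hu) mul0r.
Qed.

Lemma skew_mul1r : right_id (skew_mono 1 1%g) skew_mul.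
Proof.
move=> f; apply/ffunP => w; rewrite skew_mulE (bigD1 w) //= ffunE mulVg eqxx.
rewrite rmorph1 mulr1 big1 ?addr0 // => u hu.
by rewrite ffunE -eq_mulVg1 (negPf hu) raddf0 mulr0.
Qed.

Lemma skew_mulDl : left_distributive skew_mul +%R.
Proof.
move=> f g h; apply/ffunP => w; rewrite ffunE !skew_mulE -big_split /=.
by apply: eq_bigr => u _; rewrite ffunE mulrDl.
Qed.

Lemma skew_mulDr : right_distributive skew_mul +%R.
Proof.
move=> f g h; apply/ffunP => w; rewrite ffunE !skew_mulE -big_split /=.
by apply: eq_bigr => u _; rewrite ffunE raddfD mulrDr.
Qed.

Lemma skew_mono1_neq0 : skew_mono 1 1%g != 0.
Proof.
by apply/eqP => /ffunP/(_ 1%g); rewrite !ffunE eqxx; apply/eqP/oner_neq0.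
Qed.

HB.instance Definition _ := GRing.Zmodule_isNzRing.Build SG
  skew_mulA skew_mul1l skew_mul1r skew_mulDl skew_mulDr skew_mono1_neq0.

Lemma skew_monoM a b u v :
  skew_mono a u * skew_mono b v = skew_mono (a * act u b) (u * v)%g.
Proof.
apply/ffunP => w; rewrite [LHS]skew_mulE (bigD1 u) //= !ffunE eqxx.
rewrite big1 ?addr0 => [|x hx]; last by rewrite ffunE (negPf hx) mul0r.
rewrite -(inj_eq (mulgI u)) mulKVg.
by case: eqP => // _; rewrite raddf0 mulr0.
Qed.

(* The identification of S[G] with End_R(S). *)
Definition skew_eval f (x : S) : S := \sum_u f u * act u x.

Lemma skew_evalM f g x : skew_eval (f * g) x = skew_eval f (skew_eval g x).
Proof.
rewrite /skew_eval; under eq_bigr do rewrite [(f * g) _]skew_mulE mulr_suml.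
rewrite exchange_big /=; apply: eq_bigr => u _.
rewrite raddf_sum mulr_sumr (reindex_inj (mulgI u)) /=.
by apply: eq_bigr => v _; rewrite mulKg rmorphM actM mulrA.
Qed.

End SkewGroupAlgebra.

Section Submodules.
Variables (R : comNzRingType) (V : lmodType R).
Implicit Type M : set V.

Definition is_submodule M : Prop :=
  M 0 /\ forall (a : R) x y, M x -> M y -> M (a *: x + y).

Definition lincomb m (v : 'I_m -> V) (c : 'I_m -> R) : V :=
  \sum_(i < m) c i *: v i.

Definition generated_by M m (v : 'I_m -> V) : Prop := M = range (lincomb v).

(* r is the minimal number of generators of M; the relation holds for no r if M
   is not finitely generated. *)
Definition is_rkinn M r : Prop :=
  (exists v : 'I_r -> V, generated_by M v) /\
  forall m (v : 'I_m -> V), generated_by M v -> (r <= m)%N.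

(* Free of finite rank; a free module over a nonzero ring with finite rk_inn has
   a finite basis. *)
Definition is_free M : Prop :=
  exists m (v : 'I_m -> V),
    generated_by M v /\
    forall c : 'I_m -> R, lincomb v c = 0 -> forall i, c i = 0.

End Submodules.

Section Codes.
Variables (gT : finGroupType) (R : comNzRingType) (S : comAlgType R).
Variable act : alg_action gT S.
Implicit Type C : set (skew_group_algebra act).

Definition is_code C : Prop := is_submodule C /\ exists2 f, C f & f <> 0.

(* rk_inn(f, R) = r *)
Definition is_rkinn_elt (f : skew_group_algebra act) r : Prop :=
  is_rkinn (range (skew_eval f)) r.

(* d(C) = d *)
Definition is_min_rank_distance C d : Prop :=
  (exists f, [/\ C f, f <> 0 & is_rkinn_elt f d]) /\
  forall f r, C f -> f <> 0 -> is_rkinn_elt f r -> (d <= r)%N.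

(* The subtraction does not truncate: d <= #|gT|, as S is generated by #|gT|
   elements over R in the setting considered. *)
Definition is_mrd C : Prop :=
  [/\ is_code C, is_free C &
      exists2 d, is_min_rank_distance C d &
        is_rkinn C (#|gT| * (#|gT| - d + 1))%N].

Definition gabidulin (sigma : gT) (l : nat) : set (skew_group_algebra act) :=
  range (fun f : 'I_l -> S =>
    \sum_(i < l) skew_mono act (f i) (sigma ^+ i)%g).

End Codes.

Arguments gabidulin {gT R S} act sigma l _ : rename.

(* Main.v *)
Require Import Defs.
From mathcomp Require Import all_boot all_order all_algebra all_fingroup.
From mathcomp Require Import boolp classical_sets.
From mathcomp Require Import generic_quotient ring_quotient cyclic.
From mathcomp Require Import freeg.
From HB Require Import structures.

Set Implicit Arguments.
Unset Strict Implicit.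
Unset Printing Implicit Defensive.

Import GRing.Theory.

Local Open Scope classical_set_scope.
Local Open Scope ring_scope.
Local Open Scope quotient_scope.

(** Every nonzero element of the code is a skew polynomial of degree less than
    l in sigma, and over a cyclic field extension such a polynomial has a kernel
    of dimension at most l - 1, hence rank at least n - l + 1.  This value is
    attained, so d = n - l + 1, which is what a code of rank n l needs in order
    to be MRD; the code has that rank because S has rank n (gabidulin_basis).
    Two points need care over a local principal ideal ring S with uniformizer p:
    the reduction to the residue field, and the existence of an R-basis of S
    adapted to the action.

    The basis (galois_moore_basis).  Bijectivity of the Galois map provides
    families x, y in the big extension with sum_a x_a g(y_a) = [g = 1], so the
    matrix (sigma^i(y_a))_{a,i} has a left inverse.  Over a local ring such a
    matrix has an invertible square minor (local_minor), so n of the y_a have an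
    invertible Moore matrix W = (sigma^i(y_j))_{j,i}.  By Cramer's rule every z
    is a combination of these y_j, and the coefficients are G-invariant because
    the Galois group only permutes the equations that determine them.  Such a
    basis survives reduction modulo a power of p (unramified_structure).

    The lower bound (gabidulin_rank_bound).  Let f be a nonzero codeword.
    Write f = p^j e with p^j <> 0 and some coefficient of e nonzero modulo p.
    If r elements p^j m_a generate f(S), then, as the annihilator of p^j lies in
    (p), every e(y_j) is modulo p an R-combination of the m_a.  Let i0 < l be
    the largest degree at which e is nonzero modulo p.  The n - i0 conjugates
    sigma^k e with k < n - i0 have coefficient rows F in echelon form.  The
    matrix F W^T of their values at the y_j factors through r columns, because
    R-coefficients are fixed by sigma, and F and W are of full rank over the
    residue field, so n - i0 <= r (rank_bound_mod).  Working with all the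
    conjugates at once replaces the usual bound on the kernel.

    The minimum is attained (gabidulin_low_rank).  The first l - 1 columns of W
    contain an invertible minor, so some monic skew polynomial of degree l - 1
    kills l - 1 of the basis elements y_j, and its image is generated by the
    values at the n - l + 1 others. *)

(** * Local rings with principal maximal ideal *)

(** A ring is local with maximal ideal [principal p] exactly when this dichotomy
    holds; it is the form in which a determinant that is nonzero modulo [p] is
    seen to be invertible. *)
Definition local_at (A : comNzRingType) (p : A) : Prop :=
  ~ principal p 1 /\ forall x, principal p x \/ exists y, y * x = 1.

Section Principal.
Variables (A : comNzRingType) (p : A).

Lemma principal_ideal : is_ideal (principal p).
Proof.
split; first by exists 0; rewrite mul0r.
by move=> a _ _ [b ->] [c ->]; exists (a * b + c); rewrite mulrDl mulrA.
Qed.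

Lemma principal_self : principal p p.
Proof. by exists 1; rewrite mul1r. Qed.

End Principal.

(** Krull's theorem; the empty set is added to the family of proper ideals above
    [I] only because Zorn's lemma also asks for the union of the empty chain. *)
Lemma proper_ideal_sub_maximal (A : comNzRingType) (I : set A) :
  is_ideal I -> ~ I 1 -> exists2 J, maximal_ideal J & I `<=` J.
Proof.
move=> idI I1.
pose P (X : set A) := X = set0 \/ [/\ is_ideal X, ~ X 1 & I `<=` X].
have [F FP tot|J [PJ maxJ]] := @Zorn_bigcup _ P.
  have [[X1 [FX1 [x1 X1x1]]]|F0] :=
      pselect (exists X, F X /\ exists x, X x); last first.
    left; apply/seteqP; split=> // x [X FX Xx]; case: F0.
    by exists X; split=> //; exists x.
  right; have FPP X x : F X -> X x -> [/\ is_ideal X, ~ X 1 & I `<=` X].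
    by move=> FX Xx; case: (FP _ FX) => // X0; rewrite X0 in Xx.
  have [[X10 _] _ IX1] := FPP _ _ FX1 X1x1.
  split.
  - split; first by exists X1.
    move=> a x y [X FX Xx] [Y FY Yy].
    have [XY|YX] := tot _ _ FX FY.
      exists Y => //; have [[_ +] _ _] := FPP _ _ FY Yy; apply=> //.
      exact: XY.
    exists X => //; have [[_ +] _ _] := FPP _ _ FX Xx; apply=> //.
    exact: YX.
  - by move=> [X FX Xu]; have [_ + _] := FPP _ _ FX Xu.
  - by move=> x /IX1; exists X1.
have [idJ J1 IJ] : [/\ is_ideal J, ~ J 1 & I `<=` J].
  case: PJ => // J0; case: (maxJ I); last by right; split.
  by rewrite J0; split=> // /(_ 0 idI.1).
exists J => //; split=> //; first by move=> JT; apply: J1; rewrite JT.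
move=> K idK JK; have [K1|K1] := pselect (K 1).
  right; apply/seteqP; split=> // x _.
  by rewrite -[x]addr0 -[x]mulr1; apply: idK.2 => //; apply: idK.1.
left; apply: contrapT => KJ; apply: (maxJ K).
  by split=> // KJ'; apply: KJ; apply/seteqP; split.
by right; split=> // x /IJ /JK.
Qed.

Lemma dvr_local (A : comNzRingType) (p : A) :
  is_dvr A -> maximal_ideal (principal p) -> local_at p.
Proof.
move=> [_ _ [M [maxM uniqM]] _] maxp.
have Ep J : maximal_ideal J -> J = principal p.
  by move=> maxJ; rewrite -(uniqM _ maxJ) -(uniqM _ maxp).
split=> [p1|x].
  have [_ + _] := maxp; apply; apply/seteqP; split=> // x _.
  by case: p1 => b e; exists (x * b); rewrite -mulrA -e mulr1.
have [[y e]|x1] := pselect (principal x 1); first by right; exists y.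
have [J /Ep -> xp] := proper_ideal_sub_maximal (principal_ideal x) x1.
by left; apply/xp/principal_self.
Qed.

(** The intersection of the powers of [p] is a principal ideal [(a)]; dividing
    [a] by [p] stays in the intersection, so [a = c p a] for some [c], and then
    [a = 0] because [1 - c p] is nonzero in a domain. *)
Lemma dvr_krull (A : comNzRingType) (p : A) :
    is_dvr A -> local_at p ->
  forall x, x <> 0 -> exists j, ~ principal (p ^+ j) x.
Proof.
move=> [dom pid _ _] [p1 _] x x0; apply: contrapT => xp.
have {}xp j : principal (p ^+ j) x.
  by apply: contrapT => h; apply: xp; exists j.
pose I := [set z | forall j, principal (p ^+ j) z].
have idI : is_ideal I.
  split=> [j|a y z Iy Iz j]; first exact: (principal_ideal _).1.
  by apply: (principal_ideal _).2.
have [a Ea] := pid I idI.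
have aP : I a by rewrite Ea; apply: principal_self.
have a0 : a = 0.
  have [p0|p0] := EM (p = 0).
    by have [b ->] := aP 1%N; rewrite p0 mulr0.
  have [b eb] := aP 1%N; rewrite expr1 in eb.
  have : I b => [j|].
    have [c ec] := aP j.+1; exists c; apply/subr0_eq.
    have /dom[//|//] : p * (b - c * p ^+ j) = 0.
    by rewrite mulrBr [p * b]mulrC -eb ec mulrCA -exprS subrr.
  rewrite Ea => -[c ec].
  have /dom[//|] : a * (1 - c * p) = 0.
    by rewrite mulrBr mulr1 mulrCA mulrA -ec -eb subrr.
  by move/subr0_eq => e; case: p1; exists c.
have : I x by [].
by rewrite Ea => -[b]; rewrite a0 mulr0.
Qed.

Lemma local_image (A B : comNzRingType) (f : {rmorphism A -> B}) (p : A) :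
    (forall y, exists x, f x = y) -> (forall x, f x = 0 -> principal p x) ->
  local_at p -> local_at (f p).
Proof.
move=> surj kerf [p1 unitP]; split=> [[y]|y].
  have [x <-] := surj y; rewrite -rmorphM => e; apply: p1.
  have /kerf[c ec] : f (1 - x * p) = 0 by rewrite raddfB /= rmorph1 -e subrr.
  by exists (c + x); rewrite mulrDl -ec subrK.
have [x <-] := surj y; have [[b ->]|[b e]] := unitP x.
  by left; exists (f b); rewrite rmorphM.
by right; exists (f b); rewrite -rmorphM e rmorph1.
Qed.

(** * The residue field, and invertible minors over a local ring *)

Section ResidueField.
Variables (A : comNzRingType) (p : A) (ploc : local_at p).

(** The proof of locality is an argument so that the ideal structure, which
    depends on it, can be attached to this predicate. *)
Definition residue_ideal of local_at p : pred A :=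
  fun x => `[< principal p x >].

Lemma residue_idealr_closed : idealr_closed (residue_ideal ploc).
Proof.
have [id0 idD] := principal_ideal p; split; first exact/asboolP.
  by apply/asboolP/ploc.1.
by move=> a x y /asboolP px /asboolP py; apply/asboolP/idD.
Qed.

HB.instance Definition _ :=
  isIdealr.Build A (residue_ideal ploc) residue_idealr_closed.

Definition residue := {ideal_quot (Idealr.clone A (residue_ideal ploc) _)}.
HB.instance Definition _ := GRing.ComNzRing.on residue.

Definition residue_map (x : A) : residue := \pi_residue x.

Lemma residue_map_eq0 x : residue_map x = 0 <-> principal p x.
Proof.
rewrite /residue_map -[0](raddf0 (\pi_residue : A -> residue)).
split=> [/eqP|px]; last apply/eqP.
  by rewrite -Quotient.idealrBE subr0 => /asboolP.
by rewrite -Quotient.idealrBE subr0; apply/asboolP.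
Qed.

Lemma residue_map_is_zmod_morphism : zmod_morphism residue_map.
Proof. exact: raddfB. Qed.

Lemma residue_map_is_monoid_morphism : monoid_morphism residue_map.
Proof. by split; [exact: rmorph1|exact: rmorphM]. Qed.

HB.instance Definition _ := GRing.isZmodMorphism.Build A residue residue_map
  residue_map_is_zmod_morphism.
HB.instance Definition _ := GRing.isMonoidMorphism.Build A residue residue_map
  residue_map_is_monoid_morphism.

Definition residue_inv (x : residue) : residue := xget 0 [set y | y * x = 1].

Lemma residue_mulVf x : x != 0 -> residue_inv x * x = 1.
Proof.
rewrite -[x]reprK -[\pi_residue _]/(residue_map _) => /eqP x0.
have [/residue_map_eq0//|[y e]] := ploc.2 (repr x).
rewrite /residue_inv; case: xgetP => [//|/(_ (residue_map y)) []] /=.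
by rewrite -rmorphM e rmorph1.
Qed.

Lemma residue_inv0 : residue_inv 0 = 0.
Proof.
rewrite /residue_inv; case: xgetP => // y _ /esym/eqP.
by rewrite mulr0 oner_eq0.
Qed.

HB.instance Definition _ :=
  GRing.ComNzRing_isField.Build residue residue_mulVf residue_inv0.

End ResidueField.

(** All that is used of the construction; the bundled statement keeps the
    quotient out of later goals. *)
Lemma residue_field (A : comNzRingType) (p : A) : local_at p ->
  exists (K : fieldType) (q : {rmorphism A -> K}),
    forall x, q x = 0 <-> principal p x.
Proof.
move=> ploc; exists (residue ploc), (residue_map ploc); exact: residue_map_eq0.
Qed.

(** Over the residue field the matrix has full rank, hence a nonzero minor of
    maximal size; its lift is not in the maximal ideal, so it is a unit. *)
Lemma local_minor (A : comNzRingType) (p : A) m n (M : 'M[A]_(m, n)) N :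
    local_at p -> N *m M = 1%:M ->
  exists2 h : 'I_n -> 'I_m, injective h &
    exists N', N' *m rowsub h M = 1%:M.
Proof.
move=> ploc NM; have [K [q q0]] := residue_field ploc.
have fullM : row_full (map_mx q M).
  by apply/row_fullP; exists (map_mx q N); rewrite -map_mxM NM map_mx1.
exists (fullrankfun fullM); first exact: fullrankfun_inj.
set D := rowsub _ M; have : q (\det D) != 0.
  by rewrite -det_map_mx map_mxsub -unitfE -unitmxE fullrowsub_unit.
have [/q0 ->|[u e] _] := ploc.2 (\det D); first by rewrite eqxx.
by exists (u *: \adj D); rewrite -scalemxAl mul_adj_mx scale_scalar_mx e.
Qed.

(** * Galois extensions of local rings: bases with invertible Moore matrix *)

Section CyclicAction.
Variables (gT : finGroupType) (R : comNzRingType) (S : comAlgType R).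
Variables (act : alg_action gT S) (sigma : gT).
Hypothesis sigma_gen : <[sigma]>%g = [set: gT]%SET.

Lemma act_scalar g (r : R) : act g (r%:A) = r%:A.
Proof. by rewrite linearZ /= rmorph1. Qed.

Lemma act_factor g h x : act g x = act h (act (h^-1 * g)%g x).
Proof. by rewrite -Defs.actM mulKVg. Qed.

Lemma sigma_power g : exists i : 'I_#[sigma]%g, g = (sigma ^+ i)%g.
Proof.
have /cyclePmin[i lt_i ->] : g \in <[sigma]>%g by rewrite sigma_gen inE.
by exists (Ordinal lt_i).
Qed.

Definition moore m (y : 'I_m -> S) : 'M[S]_(m, #[sigma]%g) :=
  \matrix_(j, i) act (sigma ^+ i)%g (y j).

(** The preimage under the Galois map of the indicator function of the
    identity, written as a sum of pure tensors. *)
Lemma galois_dual_bases : is_galois act ->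
  exists m (x y : 'I_m -> S), forall g,
    \sum_a x a * act g (y a) = (g == 1%g)%:R.
Proof.
move=> [_ _ _ [f _ fK]].
have := fK [ffun g => (g == 1%g)%:R]; set t := f _ => /ffunP tE.
pose s : seq (R * (S * S)) := repr (repr t); exists (size s).
exists (fun a => (nth (0, (0, 0)) s a).1 *: (nth (0, (0, 0)) s a).2.1).
exists (fun a => (nth (0, (0, 0)) s a).2.2) => g.
have := tE g; rewrite [RHS]ffunE => <-.
rewrite /galois_tensor_map /tensor_lift -[repr t]freeg_repr fglift_Freeg.
rewrite /prelift sum_ffunE (big_nth (0, (0, 0))) big_mkord.
by apply: eq_bigr => a _; rewrite !ffunE scalerAl.
Qed.

(** The coordinates of [z] are the solution [c] of the square system
    [sum_j c_j sigma^i(y_j) = sigma^i(z)]; an element of the group permutes the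
    equations of this system, so it fixes the solution. *)
Lemma galois_moore_basis (p : S) : is_galois act -> local_at p ->
  exists y : 'I_#[sigma]%g -> S,
    (exists N, N *m moore y = 1%:M) /\
    (forall z, exists c, z = lincomb y c).
Proof.
move=> gal ploc; have [m [x [y xy]]] := galois_dual_bases gal.
have NM : (\matrix_(j < #[sigma]%g, a < m) act (sigma ^+ j)%g (x a))
    *m moore y = 1%:M.
  apply/matrixP => j i; rewrite !mxE.
  under eq_bigr => a _.
    rewrite !mxE (act_factor (sigma ^+ i)%g (sigma ^+ j)%g) -rmorphM.
    over.
  rewrite -raddf_sum xy /= rmorph_nat; congr (_ %:R); congr nat_of_bool.
  by rewrite -eq_mulVg1 eq_expg_ord.
have [h _ [N NW]] := local_minor ploc NM.
have Emoore : rowsub h (moore y) = moore (y \o h).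
  by apply/matrixP => j i; rewrite !mxE.
rewrite {}Emoore in NW.
exists (y \o h); split=> [|z]; first by exists N.
pose Z : 'rV_#[sigma]%g := \row_i act (sigma ^+ i)%g z.
have [c cW] : exists c, c *m moore (y \o h) = Z.
  by exists (Z *m N); rewrite -mulmxA NW mulmx1.
have cinv g : map_mx (act g) c = c.
  rewrite -[LHS]mulmx1 -[RHS]mulmx1 -(mulmx1C NW) !mulmxA cW; congr (_ *m _).
  apply/rowP => i; rewrite !mxE.
  have [k ek] := sigma_power (g^-1 * sigma ^+ i).
  rewrite (act_factor _ g) ek.
  have /rowP/(_ k) := cW; rewrite !mxE => <-.
  rewrite raddf_sum; apply: eq_bigr => j _ /=; rewrite !mxE rmorphM -ek.
  by rewrite /= -act_factor.
have cR j : exists r : R, c 0 j = r%:A.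
  have [_ _ inv _] := gal; apply/inv => g.
  by have /rowP/(_ j) := cinv g; rewrite mxE.
have {cR}[r cr] := choice cR; exists r.
have [k ek] := sigma_power 1%g.
have /rowP/(_ k) := cW; rewrite !mxE -ek Defs.act1 => <-.
by apply: eq_bigr => j _; rewrite mxE -ek Defs.act1 cr -scalerAl mul1r.
Qed.

End CyclicAction.

(** * Structure of an unramified extension of local principal ideal rings *)

(** In both cases of the definition the basis and the uniformizer are images of
    those of the extension of discrete valuation rings.  [R] embeds in [S]
    because, when [w^k] is nonzero, [w^k b] in the lower ring forces [b] to be
    invariant, hence to lie in the lower ring too. *)
Lemma unramified_structure (gT : finGroupType) (R : comNzRingType)
    (S : comAlgType R) (act : alg_action gT S) (sigma : gT) :
    <[sigma]>%g = [set: gT]%SET -> is_unramified_galois act ->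
  injective (fun r : R => r%:A : S) /\
  (exists p : S, [/\ local_at p,
    forall x, x <> 0 -> exists j, ~ principal (p ^+ j) x &
    forall g, act g p = p]) /\
  exists y : 'I_#[sigma]%g -> S,
    (exists N, N *m moore act sigma y = 1%:M) /\
    (forall z, exists c, z = lincomb y c).
Proof.
move=> gen [Rt [St [actt [w [pR [pS]]]]]].
move=> [[dvrR dvrS gal] [maxR maxS] [surjR surjS] [pSA pSact] ker].
have locS := dvr_local dvrS maxS; set wS : St := w%:A in maxS locS ker.
have wSX k : (w ^+ k)%:A = wS ^+ k by rewrite -in_algE rmorphXn.
have injA : injective (fun r : Rt => r%:A : St) by have [] := gal.
have kerS x : pS x = 0 -> x = 0 \/ exists2 k, (0 < k)%N &
    principal (wS ^+ k) x.
  case: ker => [[_ injS] x0|[k k0 [_ kS]]].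
    by left; apply: injS; rewrite x0 rmorph0.
  by move=> /kS kx; right; exists k => //; rewrite -wSX.
have kerR r : pS (r%:A) = 0 -> pR r = 0.
  case: ker => [[_ injS] x0|[k k0 [kR kS]] /kS[b eb]].
    suff -> : r = 0 by rewrite rmorph0.
    by apply: injA; apply: injS; rewrite x0 scale0r rmorph0.
  apply/kR; have [w0|w0] := EM (wS ^+ k = 0).
    exists 0; apply: injA.
    by rewrite eb wSX w0 mulr0 mul0r scale0r.
  have [_ _ inv _] := gal; have [dom _ _ _] := dvrS.
  have /inv[c ec] : forall g, actt g b = b.
    move=> g; apply/subr0_eq; have := act_scalar actt g r.
    rewrite eb rmorphM /= act_scalar => /eqP; rewrite -subr_eq0 -mulrBl.
    by rewrite wSX => /eqP/dom[].
  by exists c; apply: injA; rewrite /= eb ec -!in_algE rmorphM.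
split.
  move=> r s; have [rt <-] := surjR r; have [st <-] := surjR s => e.
  apply/subr0_eq; rewrite -rmorphB; apply: kerR.
  by rewrite pSA rmorphB /= scalerBl e subrr.
split.
  exists (pS wS); split.
  - apply: local_image => // x /kerS[->|[k k0 [b ->]]].
      exact: (principal_ideal _).1.
    by exists (b * wS ^+ k.-1); rewrite -mulrA -exprSr prednK.
  - move=> x x0; have [xt ex] := surjS x.
    have [xt0|xt0] := EM (xt = 0); first by case: x0; rewrite -ex xt0 rmorph0.
    case: ker => [[_ injS]|[k k0 [_ kS]]].
      have [j nj] := dvr_krull dvrS locS xt0; exists j => -[b eb]; apply: nj.
      have [bt ebt] := surjS b; exists bt; apply: injS.
      by rewrite rmorphM rmorphXn ebt ex.
    exists k => -[b eb]; apply: x0; rewrite eb -rmorphXn -wSX.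
    have -> : pS (w ^+ k)%:A = 0 by apply/kS/principal_self.
    by rewrite mulr0.
  - by move=> g; rewrite -pSact act_scalar.
have [y [[N NW] span]] := galois_moore_basis gen gal locS.
exists (pS \o y); split.
  exists (map_mx pS N).
  have -> : moore act sigma (pS \o y) = map_mx pS (moore actt sigma y).
    by apply/matrixP => j i; rewrite !mxE /= pSact.
  by rewrite -map_mxM NW map_mx1.
move=> z; have [zt <-] := surjS z; have [c ->] := span zt.
exists (pR \o c); rewrite /lincomb rmorph_sum; apply: eq_bigr => j _ /=.
by rewrite -mulr_algl rmorphM pSA mulr_algl.
Qed.

(** * Minimal numbers of generators *)

Section Generators.
Variables (R : comNzRingType) (V : lmodType R).

Lemma generated_mem (M : set V) m (v : 'I_m -> V) i :
  generated_by M v -> M (v i).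
Proof.
move=> ->; exists (fun j => (j == i)%:R) => //; rewrite /lincomb (bigD1 i) //=.
by rewrite eqxx scale1r big1 ?addr0 // => j /negPf ->; rewrite scale0r.
Qed.

Lemma generated_by_family (I : finType) (A : pred I) (v : I -> V) (M : set V) :
    (forall x, M x <-> exists c : I -> R, x = \sum_(i in A) c i *: v i) ->
  generated_by M (fun k : 'I_#|A| => v (enum_val k)).
Proof.
move=> ME; apply/seteqP; split=> [x /ME[c ->]|_ [c _ <-]].
  by exists (c \o enum_val) => //; rewrite big_enum_val.
apply/ME; exists (fun i => \sum_(k < #|A| | enum_val k == i) c k).
rewrite big_enum_val /lincomb; apply: eq_bigr => k _.
by rewrite (big_pred1 k) // => k'; rewrite (inj_eq enum_val_inj).
Qed.

(** Expressing the basis in the generators and back gives a factorization of the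
    identity matrix, which over a nonzero commutative ring cannot pass through a
    smaller size. *)
Lemma rkinn_free m (v : 'I_m -> V) (M : set V) :
    generated_by M v -> (forall c, lincomb v c = 0 -> forall i, c i = 0) ->
  is_rkinn M m.
Proof.
move=> Mv vfree; split=> [|k u Mu]; first by exists v.
have /choice[B vB] i : exists b, v i = lincomb u b.
  by have := generated_mem i Mv; rewrite Mu => -[b _ <-]; exists b.
have /choice[D uD] a : exists d, u a = lincomb v d.
  by have := generated_mem a Mu; rewrite Mv => -[d _ <-]; exists d.
apply: (@mulmx1_min R _ _ (\matrix_(i, a) B i a) (\matrix_(a, j) D a j)).
apply/matrixP => i j; rewrite !mxE; apply/subr0_eq.
under eq_bigr => a _ do rewrite !mxE.
move: j; apply: vfree; rewrite /lincomb.
under eq_bigr => j _ do rewrite scalerBl.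
have vi : \sum_j (i == j)%:R *: v j = v i.
  rewrite (bigD1 i) //= eqxx scale1r big1 ?addr0 // => j.
  by rewrite eq_sym => /negPf ->; rewrite scale0r.
rewrite sumrB vi vB /lincomb; apply/eqP; rewrite subr_eq0; apply/eqP.
under eq_bigr do rewrite scaler_suml.
rewrite exchange_big; apply: eq_bigr => a _ /=.
by rewrite uD /lincomb scaler_sumr; apply: eq_bigr => j _; rewrite scalerA.
Qed.

End Generators.

(** * Powers of the uniformizer *)

Section Valuation.
Variables (A : comNzRingType) (p : A).
Hypothesis ploc : local_at p.

Lemma annihilator_power j b : p ^+ j <> 0 -> b * p ^+ j = 0 -> principal p b.
Proof.
move=> pj0 bp0; have [//|[u ub]] := ploc.2 b.
by case: pj0; rewrite -[p ^+ j]mul1r -ub -mulrA bp0 mulr0.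
Qed.

(** The power extracted is the largest that divides the whole family. *)
Lemma extract_power (I : Type) (f : I -> A) (i : I) :
    (exists j, ~ principal (p ^+ j) (f i)) ->
  exists j e, [/\ p ^+ j <> 0, forall i, f i = e i * p ^+ j &
    exists i, ~ principal p (e i)].
Proof.
move=> [j0 nj0].
have exP : exists j, `[< exists i, ~ principal (p ^+ j) (f i) >].
  by exists j0; apply/asboolP; exists i.
case: (ex_minnP exP) => -[/asboolP[k []]|j /asboolP[k nk] minj].
  by exists (f k); rewrite mulr1.
have /choice[e fe] k' : exists b, f k' = b * p ^+ j.
  apply: contrapT => nk'; suff : (j.+1 <= j)%N by rewrite ltnn.
  by apply/minj/asboolP; exists k'.
exists j, e; split=> //.
  by move=> pj0; apply: nk; rewrite fe pj0; exists 0; rewrite mulr0 mul0r.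
by exists k => -[b eb]; apply: nk; exists b; rewrite fe eb -mulrA -exprS.
Qed.

End Valuation.

(** * Gabidulin codes *)

Section CodeCoefficients.
Variables (gT : finGroupType) (R : comNzRingType) (S : comAlgType R).
Variables (act : alg_action gT S) (sigma : gT).
Hypothesis sigma_gen : <[sigma]>%g = [set: gT]%SET.
Local Notation n := #[sigma]%g.
Local Notation SG := (skew_group_algebra act).

Lemma card_gen : #|gT| = n.
Proof. by rewrite -cardsT -sigma_gen. Qed.

Lemma sigma_power_inj : injective (fun i : 'I_n => sigma ^+ i)%g.
Proof. by move=> i j /eqP; rewrite eq_expg_ord // => /eqP. Qed.

Lemma skew_eval_powers (f : SG) x :
  skew_eval f x = \sum_(i < n) f (sigma ^+ i)%g * act (sigma ^+ i)%g x.
Proof.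
rewrite /skew_eval (reindex (fun i : 'I_n => sigma ^+ i)%g) //.
apply/onW_bij/inj_card_bij; first exact: sigma_power_inj.
by rewrite card_gen card_ord.
Qed.

Lemma skew_eval_lincomb (f : SG) m (y : 'I_m -> S) (c : 'I_m -> R) :
  skew_eval f (lincomb y c) = \sum_j c j *: skew_eval f (y j).
Proof.
rewrite /skew_eval /lincomb; under eq_bigr do rewrite raddf_sum mulr_sumr.
rewrite exchange_big; apply: eq_bigr => j _; rewrite scaler_sumr.
by apply: eq_bigr => u _; rewrite /= linearZ scalerAr.
Qed.

Lemma gabidulin_coef l (c : 'I_l -> S) (k : 'I_n) : (l <= n)%N ->
  (\sum_(i < l) skew_mono act (c i) (sigma ^+ i)%g) (sigma ^+ k)%g =
  \sum_(i < l | i == k :> nat) c i.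
Proof.
move=> le_ln; rewrite sum_ffunE [RHS]big_mkcond; apply: eq_bigr => i _.
by rewrite ffunE (eq_expg_ord k (widen_ord le_ln i)) // -val_eqE eq_sym.
Qed.

Lemma gabidulinP l (f : SG) : (l <= n)%N ->
  gabidulin act sigma l f <->
  forall k : 'I_n, (l <= k)%N -> f (sigma ^+ k)%g = 0.
Proof.
move=> le_ln; split=> [[c _ <-] k le_lk|f0].
  rewrite gabidulin_coef // big1 // => i /eqP ik.
  by move: (ltn_ord i); rewrite ik ltnNge le_lk.
exists (fun i => f (sigma ^+ i)%g) => //; apply/ffunP => g.
have [k ->] := sigma_power sigma_gen g; rewrite gabidulin_coef //.
case: (ltnP k l) => [lt_kl|le_lk].
  by rewrite (big_pred1 (Ordinal lt_kl)).
rewrite f0 // big1 // => i /eqP ik.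
by move: (ltn_ord i); rewrite ik ltnNge le_lk.
Qed.

Lemma gabidulin_submodule l : (l <= n)%N ->
  is_submodule (gabidulin act sigma l).
Proof.
move=> le_ln; split=> [|a f g].
  by apply/gabidulinP => // k _; rewrite ffunE.
move=> /gabidulinP-/(_ le_ln) f0 /gabidulinP-/(_ le_ln) g0.
apply/gabidulinP => // k lk.
by rewrite !ffunE f0 // g0 // scaler0 addr0.
Qed.

Section Basis.
Variables (p : S) (y : 'I_n -> S) (N : 'M[S]_n).
Hypothesis injA : injective (fun r : R => r%:A : S).
Hypothesis ploc : local_at p.
Hypothesis pfix : forall g, act g p = p.
Hypothesis krull : forall x, x <> 0 -> exists j, ~ principal (p ^+ j) x.
Hypothesis NW : N *m moore act sigma y = 1%:M.
Hypothesis span : forall z, exists c, z = lincomb y c.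

(** Applying the powers of [sigma] to a relation with coefficients in [R] puts
    the coefficients in the left kernel of the Moore matrix. *)
Lemma moore_free c : lincomb y c = 0 -> forall j, c j = 0.
Proof.
move=> yc j; apply: injA; rewrite /= scale0r.
have cW : (\row_j (c j)%:A) *m moore act sigma y = 0.
  apply/rowP => i; rewrite [RHS]mxE.
  transitivity (act (sigma ^+ i)%g (lincomb y c)); last by rewrite yc raddf0.
  rewrite mxE /lincomb raddf_sum; apply: eq_bigr => k _ /=.
  by rewrite !mxE linearZ mulr_algl.
have /rowP/(_ j) : \row_j (c j)%:A = 0 :> 'rV[S]_n.
  by rewrite -[LHS]mulmx1 -(mulmx1C NW) mulmxA cW mul0mx.
by rewrite !mxE.
Qed.

Lemma gabidulin_basis l : (l <= n)%N ->
  exists v : 'I_(l * n) -> SG, generated_by (gabidulin act sigma l) v /\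
    forall c, lincomb v c = 0 -> forall i, c i = 0.
Proof.
move=> le_ln; have -> : (l * n)%N = #|[pred _ : 'I_l * 'I_n | true]|.
  by rewrite -[RHS]/#|{: 'I_l * 'I_n}| card_prod !card_ord.
pose v (ij : 'I_l * 'I_n) : SG := skew_mono act (y ij.2) (sigma ^+ ij.1)%g.
have vE (c : 'I_l * 'I_n -> R) :
    \sum_(ij in [pred _ : 'I_l * 'I_n | true]) c ij *: v ij =
    \sum_(i < l) skew_mono act (lincomb y (fun j => c (i, j))) (sigma ^+ i)%g.
  rewrite (eq_bigr (fun ij => c (ij.1, ij.2) *: v (ij.1, ij.2))); last by case.
  rewrite -(pair_bigA _ (fun i j => c (i, j) *: v (i, j))) /=.
  apply: eq_bigr => i _; apply/ffunP => g; rewrite sum_ffunE ffunE.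
  under eq_bigr do rewrite !ffunE /=.
  by case: (g == _) => //; apply: big1 => j _; rewrite scaler0.
exists (fun k => v (enum_val k)); split.
  apply: generated_by_family => f; split=> [[e _ <-]|[c ->]].
    have /choice[c ec] i : exists c, e i = lincomb y c by [].
    exists (fun ij => c ij.1 ij.2); rewrite vE /=; apply: eq_bigr => i _.
    by rewrite ec.
  by rewrite vE; exists (fun i => lincomb y (fun j => c (i, j))).
move=> c; pose c' ij :=
  c (enum_rank_in (isT : ij \in [pred _ : 'I_l * 'I_n | true]) ij).
have -> : lincomb (fun k => v (enum_val k)) c =
    \sum_(ij in [pred _ : 'I_l * 'I_n | true]) c' ij *: v ij.
  rewrite big_enum_val; apply: eq_bigr => k _.
  by rewrite /c' enum_valK_in.
rewrite vE => /ffunP c0 k.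
have -> : c k = c' (enum_val k) by rewrite /c' enum_valK_in.
case: (enum_val k) => i j.
have := c0 (sigma ^+ (widen_ord le_ln i))%g.
rewrite gabidulin_coef // (big_pred1 i) // ffunE.
by move/moore_free/(_ j).
Qed.

(** Over the residue field, the values of the conjugates [sigma^k e], for
    [k < n - i0], at the elements [y j] form the matrix [F W^T] with [W]
    invertible.  The same values are combinations of the [sigma^k (m a)] with
    coefficients that do not depend on [k].  As [F] has a triangular minor of
    size [n - i0], this size is at most the number [r] of elements [m a]. *)
Lemma rank_bound_mod (e : SG) (i0 : 'I_n) r (m : 'I_r -> S)
    (C : 'I_r -> 'I_n -> R) :
    ~ principal p (e (sigma ^+ i0)%g) ->
    (forall i : 'I_n, (i0 < i)%N -> principal p (e (sigma ^+ i)%g)) ->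
    (forall j, principal p (skew_eval e (y j) - \sum_a C a j *: m a)) ->
  (n - i0 <= r)%N.
Proof.
move=> e0 e_gt eC; have [K [q q0]] := residue_field ploc.
have act_p g x : principal p x -> principal p (act g x).
  by case=> b ->; exists (act g b); rewrite rmorphM /= pfix.
pose W := map_mx q (moore act sigma y).
have WN : W^T *m (map_mx q N)^T = 1%:M.
  by rewrite -trmx_mul -map_mxM NW map_mx1 trmx1.
pose s := (n - i0)%N.
(* The coefficient of sigma^k e at sigma^(i + k), modulo p. *)
pose G k i := q (act (sigma ^+ k)%g (e (sigma ^+ i)%g)).
pose F := \matrix_(k < s, t < n) if (k <= t)%N then G k (t - k)%N else 0.
pose V := \matrix_(k < s, a < r) q (act (sigma ^+ k)%g (m a)).
pose D := \matrix_(a < r, j < n) q (C a j)%:A.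
have G0 k i : (i0 < i)%N -> (i < n)%N -> G k i = 0.
  by move=> lt_i lt_in; apply/q0/act_p/(e_gt (Ordinal lt_in)).
have FW : F *m W^T = V *m D.
  apply/matrixP => k j; rewrite !mxE.
  (* The terms with i >= n - k vanish, since k < n - i0 then gives i > i0; so no
     exponent i + k has to be reduced modulo n. *)
  pose H i := G k i * q (act (sigma ^+ (i + k))%g (y j)).
  transitivity (\sum_(0 <= i < n) H i).
    rewrite (eq_bigr (fun t : 'I_n => if (k <= t)%N then H (t - k)%N else 0)).
      rewrite -(big_mkord xpredT
        (fun t => if (k <= t)%N then H (t - k)%N else 0)).
      have le_kn : (k <= n)%N.
        by rewrite (leq_trans (ltnW (ltn_ord k))) ?leq_subr.
      rewrite (big_cat_nat _ le_kn) //= big_nat big1 ?add0r; last first.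
        by move=> t /andP[_]; rewrite ltnNge => /negPf ->.
      rewrite -{1}[k : nat]add0n big_addn.
      rewrite [RHS](big_cat_nat _ (leq_subr k n)) //=.
      rewrite [X in _ = _ + X]big_nat [X in _ = _ + X]big1 ?addr0;
          last move=> i /andP[le_i lt_i].
        by apply: eq_bigr => t _; rewrite leq_addl addnK.
      rewrite /H G0 ?mul0r // (leq_trans _ le_i) // ltn_subRL addnC -ltn_subRL.
      exact: ltn_ord.
    move=> t _; rewrite !mxE; case: leqP => [le_kt|]; last by rewrite mul0r.
    by rewrite /H subnK.
  rewrite big_mkord; have /(act_p (sigma ^+ k)%g)/q0 := eC j.
  rewrite skew_eval_powers !raddfB /= => /eqP; rewrite subr_eq0 => /eqP eq_k.
  transitivity (q (act (sigma ^+ k)%g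
    (\sum_(i < n) e (sigma ^+ i)%g * act (sigma ^+ i)%g (y j)))).
    rewrite !raddf_sum /=; apply: eq_bigr => i _.
    by rewrite !rmorphM /= -Defs.actM -expgD addnC.
  rewrite eq_k !raddf_sum; apply: eq_bigr => a _.
  by rewrite /= !mxE linearZ /= -[_ *: act _ _]mulr_algl rmorphM mulrC.
(* The columns i0, i0 + 1, ... of F form a triangular matrix whose diagonal
   entries are the conjugates of the coefficient of e at i0. *)
have shift_lt (k : 'I_s) : (i0 + k < n)%N by rewrite -ltn_subRL.
pose g k := Ordinal (shift_lt k).
pose U := colsub g F.
have unitU : U \in unitmx.
  have trigU : is_trig_mx U.
    apply/is_trig_mxP => k k' lt_kk'; rewrite !mxE /=.
    have le_k : (k <= i0 + k')%N by rewrite (leq_trans (ltnW lt_kk')) ?leq_addl.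
    rewrite le_k G0 //; first by rewrite ltn_subRL addnC ltn_add2l.
    by rewrite (leq_ltn_trans (leq_subr _ _)).
  rewrite unitmxE det_trig // unitfE; apply/prodf_neq0 => k _.
  rewrite !mxE /= leq_addl addnK /G; apply/eqP => /q0/(act_p (sigma ^+ k)^-1%g).
  by rewrite -Defs.actM mulVg Defs.act1.
apply: (@mulmx1_min _ _ _ V (D *m (map_mx q N)^T *m colsub g 1%:M *m invmx U)).
rewrite !mulmxA -FW -(mulmxA F) WN mulmx1 mulmx_colsub mulmx1.
exact: mulmxV.
Qed.

(** Extracting from [f] the largest power [p^j] leaves a skew polynomial [e]
    that is nonzero modulo [p], and relations between values of [f] hold for
    [e] up to the annihilator of [p^j], that is modulo [p]. *)
Lemma gabidulin_rank_bound l (f : SG) r (v : 'I_r -> S) :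
    (0 < l <= n)%N -> gabidulin act sigma l f -> f <> 0 ->
    generated_by (range (skew_eval f)) v ->
  (n - l.-1 <= r)%N.
Proof.
move=> /andP[l_gt0 le_ln] /gabidulinP-/(_ le_ln) fl f0 fv.
have [g fg0] : exists g, f g <> 0.
  apply: contrapT => nf; apply: f0; apply/ffunP => g; rewrite ffunE.
  by apply: contrapT => fg; apply: nf; exists g.
have [j [e [pj0 fe [g1 ne]]]] := extract_power (krull fg0).
pose e' : SG := [ffun g => e g].
have fe' x : skew_eval f x = skew_eval e' x * p ^+ j.
  rewrite /skew_eval mulr_suml; apply: eq_bigr => u _.
  by rewrite fe ffunE mulrAC.
have e'l (k : 'I_n) : (l <= k)%N -> principal p (e' (sigma ^+ k)%g).
  move=> lk; apply: (annihilator_power ploc pj0).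
  by rewrite ffunE -fe fl.
have [k1 ek1] := sigma_power sigma_gen g1.
pose P := [pred k : 'I_n | `[< ~ principal p (e' (sigma ^+ k)%g) >]].
have Pk1 : P k1 by apply/asboolP; rewrite ffunE -ek1.
case: (arg_maxnP (fun k : 'I_n => k : nat) Pk1) => i0 /asboolP ni0 max_i0.
have lt_i0l : (i0 < l)%N by rewrite ltnNge; apply/negP => /e'l.
have /choice[x vx] a : exists x, v a = skew_eval f x.
  by have [x _ <-] := generated_mem a fv; exists x.
have /choice[C fC] i : exists C, skew_eval f (y i) = lincomb v C.
  have : range (skew_eval f) (skew_eval f (y i)) by exists (y i).
  by rewrite fv => -[C _ <-]; exists C.
apply: leq_trans (_ : n - i0 <= r)%N.
  by rewrite leq_sub2l // -ltnS prednK.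
apply: (@rank_bound_mod e' i0 r (fun a => skew_eval e' (x a))
  (fun a i => C i a)) => //.
  move=> i lt_i; apply: contrapT => ni.
  have /max_i0 : P i by apply/asboolP.
  by rewrite /= leqNgt lt_i.
move=> i; apply: (annihilator_power ploc pj0).
rewrite mulrBl -fe' fC /lincomb mulr_suml -sumrB big1 // => a _.
by rewrite vx fe' -scalerAl subrr.
Qed.

(** A monic skew polynomial of degree [l] that kills the [y (h j)], for [h]
    selecting an invertible minor of the first [l] columns of the Moore
    matrix. *)
Lemma gabidulin_low_rank l : (l < n)%N ->
  exists f : SG, [/\ gabidulin act sigma l.+1 f, f <> 0 &
    exists v : 'I_(n - l) -> S, generated_by (range (skew_eval f)) v].
Proof.
move=> lt_ln; pose w := widen_ord (ltnW lt_ln).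
pose M := colsub w (moore act sigma y).
have NM : rowsub w N *m M = 1%:M.
  rewrite -mxsub_mul NW; apply/matrixP => i j; rewrite !mxE.
  by rewrite -[RHS]/((i == j)%:R) -val_eqE.
have [h h_inj [N' NU]] := local_minor ploc NM.
pose b := \col_j act (sigma ^+ l)%g (y (h j)).
have [a Ua] : exists a, rowsub h M *m a = - b.
  by exists (N' *m - b); rewrite mulmxA (mulmx1C NU) mul1mx.
pose c (i : 'I_l.+1) := if unlift ord_max i is Some k then a k 0 else 1.
pose f : SG := \sum_(i < l.+1) skew_mono act (c i) (sigma ^+ i)%g.
have fC : gabidulin act sigma l.+1 f by exists c.
have fl (i : 'I_l.+1) : f (sigma ^+ i)%g = c i.
  rewrite -[i : nat]/(widen_ord lt_ln i : nat) gabidulin_coef //.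
  by rewrite (big_pred1 i).
have f_eval x : skew_eval f x = \sum_(i < l) a i 0 * act (sigma ^+ i)%g x
    + act (sigma ^+ l)%g x.
  rewrite skew_eval_powers.
  rewrite -(big_mkord xpredT
    (fun i => f (sigma ^+ i)%g * act (sigma ^+ i)%g x)).
  rewrite (big_cat_nat _ lt_ln) //= [X in _ + X]big_nat [X in _ + X]big1 ?addr0.
    rewrite big_mkord big_ord_recr /=; congr (_ + _).
      apply: eq_bigr => i _; have := fl (widen_ord (leqnSn l) i) => /= ->.
      have -> : widen_ord (leqnSn l) i = fintype.lift ord_max i.
        by apply: val_inj; rewrite /= /bump leqNgt ltn_ord.
      by rewrite /c liftK.
    by have := fl ord_max => /= ->; rewrite /c unlift_none mul1r.
  move=> i /andP[lt_li lt_in].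
  have /gabidulinP-/(_ lt_ln)/(_ (Ordinal lt_in)) -> // := fC.
  by rewrite mul0r.
exists f; split=> //.
  move=> /ffunP/(_ (sigma ^+ l)%g).
  have := fl ord_max => /= ->; rewrite /c unlift_none ffunE.
  by apply/eqP/oner_neq0.
have fh j : skew_eval f (y (h j)) = 0.
  rewrite f_eval; apply/eqP; rewrite addr_eq0; apply/eqP.
  have /colP/(_ j) := Ua; rewrite !mxE => <-.
  by apply: eq_bigr => i _; rewrite !mxE mulrC.
have -> : (n - l)%N = #|[pred j | j \notin codom h]|.
  apply/eqP; rewrite -(eqn_add2l l) subnKC ?(ltnW lt_ln) //.
  by rewrite -[X in (X + _)%N]card_ord -(card_codom h_inj) cardC card_ord.
exists (fun k => skew_eval f (y (enum_val k))).
apply: (generated_by_family (v := fun j => skew_eval f (y j))) => z.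
split=> [[x _ <-]|[d ->]].
  have [d ->] := span x; exists d.
  rewrite skew_eval_lincomb (bigID (mem (codom h))) /= big1 ?add0r //.
  by move=> _ /codomP[j ->]; rewrite fh scaler0.
exists (lincomb y (fun j => if j \in codom h then 0 else d j)) => //.
rewrite skew_eval_lincomb [RHS]big_mkcond; apply: eq_bigr => j _.
by rewrite inE; case: ifP => //= _; rewrite scale0r.
Qed.

End Basis.
End CodeCoefficients.

Theorem proposition2p27 (R : comNzRingType) (S : comAlgType R)
    (gT : finGroupType) (act : alg_action gT S) (sigma : gT) (n l : nat)
    (sigma_gen : <[sigma]>%g = [set: gT]%SET) (sigma_order : #[sigma]%g = n)
    (unram : is_unramified_galois act) (l_bounds : (0 < l <= n)%N) :
  is_mrd (gabidulin act sigma l).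
Proof.
have [injA [[p [ploc krull pfix]] [y [[N NW] span]]]] :=
  unramified_structure sigma_gen unram.
move: l_bounds; rewrite -{n}sigma_order; case: l => // l lt_ln.
have [f [fC f0 [v fv]]] := gabidulin_low_rank sigma_gen ploc NW span lt_ln.
have bound := gabidulin_rank_bound sigma_gen ploc pfix krull NW lt_ln.
have [b [bC bfree]] := gabidulin_basis injA NW span lt_ln.
split.
- by split; [exact: gabidulin_submodule|exists f].
- by exists (l.+1 * #[sigma]%g)%N, b.
exists (#[sigma]%g - l)%N.
  split=> [|g r gC g0 [[u gu] _]]; last exact: bound gC g0 gu.
  exists f; split=> //; split=> [|m u fu]; first by exists v.
  exact: bound fC f0 fu.
rewrite (card_gen sigma_gen) subKn ?(ltnW lt_ln) // addn1 mulnC.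
exact: rkinn_free bC bfree.
Qed.
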